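(* Let $U\subset\mathbb{R}^N$ be open and let $\{\beta_{ij}\}_{i\ne j}$ be smooth real functions on $U$ solving the symmetric Darboux equations $$\frac{\partial\beta_{ij}}{\partial u_k}=\beta_{ik}\beta_{kj}\ \ (i,j,k\text{ pairwise different}),\qquad \beta_{ij}=\beta_{ji}\ \ (i\neq j).$$ Let $V$ be a finite-dimensional real coordinate space, let $\xi_i:U\to V$ and $\xi_i^*:U\to V^*$, $i=1,\dots,N$, be smooth with $\frac{\partial\xi_j}{\partial u_i}=\beta_{ji}\xi_i$ and $\frac{\partial\xi_j^*}{\partial u_i}=\beta_{ij}\xi_i^*$ for $i\ne j$, and let $\Omega(\xi,\xi^* )$ be a potential, invertible at every point of $U$. Suppose that, for some linear operator $L$ on $V$, $$\xi_i^*=\xi_i^{\mathrm t}L\quad(i=1,\dots,N),\qquad L^{\mathrm t}\,\Omega(\xi,\xi^* )-\Omega(\xi,\xi^* )^{\mathrm t}L=0 .$$ Then the transformed functions $$\hat\beta_{ij}=\beta_{ij}-\langle\xi_j^*,\Omega(\xi,\xi^* )^{-1}\xi_i\rangle,\qquad i\neq j,$$ again solve the symmetric Darboux equations: $$\frac{\partial\hat\beta_{ij}}{\partial u_k}=\hat\beta_{ik}\hat\beta_{kj}\ \ (i,j,k\text{ pairwise different}),\qquad \hat\beta_{ij}=\hat\beta_{ji}\ \ (i\neq j).$$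
   Context: Elements of $V=\mathbb{R}^m$ are column vectors, elements of $V^*$ are row vectors, ${}^{\mathrm t}$ denotes transpose and $\langle\cdot,\cdot\rangle$ is the pairing of $V^*$ with $V$. A potential $\Omega(\xi,\xi^* )$ is a smooth function on $U$ with values in the linear maps $V\to V$ such that $\frac{\partial\Omega(\xi,\xi^* )}{\partial u_i}=\xi_i\otimes\xi_i^*$ (the matrix product $\xi_i\xi_i^*$) for $i=1,\dots,N$. It is determined up to an additive constant. *)

(* Defs.v *)
From HB Require Import structures.
From mathcomp Require Import all_boot all_order all_algebra.
From mathcomp Require Import all_classical all_reals all_analysis.

Set Implicit Arguments.
Unset Strict Implicit.
Unset Printing Implicit Defensive.

Import Order.TTheory GRing.Theory Num.Theory.
Import numFieldNormedType.Exports.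

Local Open Scope classical_set_scope.
Local Open Scope ring_scope.

(** Functions on an open set [U] of [R^N] are represented by total functions on
    ['rV[R]_N]; since [U] is open, all conditions below depend only on their
    values on [U]. *)

Section Calculus.
Context {R : realType} {N : nat} {W : normedModType R}.
Implicit Types (U : set 'rV[R]_N) (f : 'rV[R]_N -> W) (u : 'rV[R]_N).

(** [is_partial i f u d]: the partial derivative of [f] with respect to [u_i]
    exists at the point [u] and is equal to [d]. *)
Definition is_partial (i : 'I_N) f u (d : W) : Prop :=
  is_derive u (delta_mx 0 i : 'rV[R]_N) f d.

(** All iterated partial derivatives of order at most [k] exist and are
    continuous on [U]. *)
Fixpoint Ck_on (k : nat) U f : Prop :=
  (forall u, U u -> {for u, continuous f}) /\
  (if k is k'.+1 then
     forall i : 'I_N,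
       (forall u, U u -> derivable f u (delta_mx 0 i : 'rV[R]_N)) /\
       Ck_on k' U ('D_(delta_mx 0 i : 'rV[R]_N) f)
   else True).

Definition smooth_on U f : Prop := forall k, Ck_on k U f.

End Calculus.

Section Darboux.
Context {R : realType} {N m : nat}.
Implicit Types (U : set 'rV[R]_N).

(** The diagonal entries [beta i i] are unconstrained: only [beta i j] with
    [i != j] is ever used. *)
Record symmetric_darboux U (beta : 'I_N -> 'I_N -> 'rV[R]_N -> R) : Prop := {
  darboux_smooth : forall i j : 'I_N, i != j -> smooth_on U (beta i j);
  darboux_eq : forall i j k : 'I_N, i != j -> j != k -> i != k ->
    forall u, U u -> is_partial k (beta i j) u (beta i k u * beta k j u);
  darboux_sym : forall i j : 'I_N, i != j -> forall u, U u -> beta i j u = beta j i u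
}.

Definition pairing (a : 'rV[R]_m) (v : 'cV[R]_m) : R := (a *m v) 0 0.

(** [Omega] is a potential [Omega(xi, xis)]; the tensor product of [xi i] and
    [xis i] is the rank one matrix [xi i *m xis i]. *)
Record is_potential U (xi : 'I_N -> 'rV[R]_N -> 'cV[R]_m)
    (xis : 'I_N -> 'rV[R]_N -> 'rV[R]_m) (Omega : 'rV[R]_N -> 'M[R]_m) : Prop := {
  potential_smooth : smooth_on U Omega;
  potential_eq : forall i u, U u -> is_partial i Omega u (xi i u *m xis i u)
}.

Definition beta_hat (beta : 'I_N -> 'I_N -> 'rV[R]_N -> R)
    (xi : 'I_N -> 'rV[R]_N -> 'cV[R]_m) (xis : 'I_N -> 'rV[R]_N -> 'rV[R]_m)
    (Omega : 'rV[R]_N -> 'M[R]_m) (i j : 'I_N) (u : 'rV[R]_N) : R :=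
  beta i j u - pairing (xis j u) (invmx (Omega u) *m xi i u).

End Darboux.

(* Main.v *)
(** Since [d_k Omega = xi_k xis_k], one has
    [d_k Omega^-1 = - Omega^-1 xi_k xis_k Omega^-1]; differentiating
    [beta_hat i j] with the product rule gives four terms, which factor as
    [beta_hat i k * beta_hat k j].  For the symmetry, [L^T Omega = Omega^T L]
    says that [L Omega^-1] is a symmetric matrix, and the correction term is
    its bilinear form [xi_j^T (L Omega^-1) xi_i].  Smoothness of [Omega^-1]
    comes from Cramer's rule. *)

Require Import Defs.
From mathcomp Require Import all_boot all_order all_algebra.
From mathcomp Require Import all_classical all_reals all_analysis.
From mathcomp Require Import ring.
Import GRing.Theory numFieldNormedType.Exports.
Local Open Scope classical_set_scope.
Local Open Scope ring_scope.

(** * Closure of smooth functions on an open set under the algebraic operations *)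

Section SmoothOn.
Set Implicit Arguments.
Unset Strict Implicit.
Unset Printing Implicit Defensive.
Context {R : realType} {N : nat}.
Implicit Types (U : set 'rV[R]_N) (u : 'rV[R]_N).

Lemma open_near_eq {T : topologicalType} {W : Type} (U : set T) (f g : T -> W)
    (u : T) : open U -> {in U, f =1 g} -> U u -> \near u, f u = g u.
Proof.
move=> oU fg Uu; apply: filterS (open_nbhs_nbhs (conj oU Uu)) => y Uy.
by apply: fg; rewrite inE.
Qed.

(** As [U] is open, equality on [U] is equality near each of its points, so continuity, derivability
    and the derivatives themselves transfer. This is what lets differentiation rules valid only on
    [U] be used for derivatives that are total functions. *)
Lemma Ck_on_ext {W : normedModType R} k U (f g : 'rV[R]_N -> W) :
  open U -> {in U, f =1 g} -> Ck_on k U f -> Ck_on k U g.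
Proof.
move=> oU; elim: k f g => [|k IH] f g fg [cf df].
all: have nfg u (Uu : U u) := open_near_eq oU fg Uu.
all: have cg u (Uu : U u) : {for u, continuous g}.
1,3: by rewrite /prop_for /continuous_at -(fg u) ?inE//;
  apply: cvg_trans (cf u Uu); exact: (near_eq_cvg (nfg u Uu)).
- by split.
- split=> // i; have [dfi Dfi] := df i; split=> [u Uu|].
    by apply: near_eq_derivable (dfi u Uu); exact: nfg.
  apply: IH Dfi => u; rewrite inE => Uu.
  by apply: near_eq_derive; exact: nfg.
Qed.

Lemma Ck_onS {W : normedModType R} k U (f : 'rV[R]_N -> W) :
  Ck_on k.+1 U f -> Ck_on k U f.
Proof.
elim: k f => [|k IH] f; first by case.
move=> [cf df]; split=> // i; have [dfi Dfi] := df i.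
by split=> //; exact: IH.
Qed.

Lemma Ck_on_cst {W : normedModType R} k U (c : W) : Ck_on k U (fun=> c).
Proof.
elim: k c => [|k IH] c; split=> //; try by move=> u _; exact: cst_continuous.
move=> i; split=> [u _|]; first exact: derivable_cst.
suff -> : 'D_(delta_mx 0 i) (fun=> c) = (fun=> 0) :> ('rV[R]_N -> W) by [].
by apply/funext => u; rewrite derive_cst.
Qed.

Lemma Ck_onD {W : normedModType R} k U (f g : 'rV[R]_N -> W) : open U ->
  Ck_on k U f -> Ck_on k U g -> Ck_on k U (fun u => f u + g u).
Proof.
move=> oU; elim: k f g => [|k IH] f g [cf df] [cg dg].
  by split=> // u Uu; apply: continuousD; [exact: cf|exact: cg].
split=> [u Uu|i]; first by apply: continuousD; [exact: cf|exact: cg].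
have [dfi Dfi] := df i; have [dgi Dgi] := dg i; split=> [u Uu|].
  by apply: derivableD; [exact: dfi|exact: dgi].
apply: Ck_on_ext (IH _ _ Dfi Dgi) => // u; rewrite inE => Uu.
by rewrite -deriveD; [|exact: dfi|exact: dgi].
Qed.

(** By the product rule the derivative is [f * Dg + g * Df]; the undifferentiated factors are
    lowered from order [k.+1] to [k] so that the induction applies to both products. *)
Lemma Ck_onM k U (f g : 'rV[R]_N -> R) : open U ->
  Ck_on k U f -> Ck_on k U g -> Ck_on k U (fun u => f u * g u).
Proof.
move=> oU; elim: k f g => [|k IH] f g Cf Cg; have [cf df] := Cf;
  have [cg dg] := Cg; split=> //;
  try by move=> u Uu; apply: continuousM; [exact: cf|exact: cg].
move=> i; have [dfi Dfi] := df i; have [dgi Dgi] := dg i; split=> [u Uu|].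
  by apply: derivableM; [exact: dfi|exact: dgi].
have := Ck_onD oU (IH _ _ (Ck_onS Cf) Dgi) (IH _ _ (Ck_onS Cg) Dfi).
apply: Ck_on_ext => // u; rewrite inE => Uu.
by symmetry; apply: deriveM; [exact: dfi|exact: dgi].
Qed.

(** The derivative [- f^-1 * f^-1 * Df] involves the inverse only to order [k], where the induction
    hypothesis covers it. *)
Lemma Ck_onV k U (f : 'rV[R]_N -> R) : open U -> (forall u, U u -> f u != 0) ->
  Ck_on k U f -> Ck_on k U (fun u => (f u)^-1).
Proof.
move=> oU f0; elim: k => [|k IH] Cf; have [cf df] := Cf; split=> //;
  try by move=> u Uu; apply: continuousV; [exact: f0|exact: cf].
move=> i; have [dfi Dfi] := df i; split=> [u Uu|].
  by apply: derivableV; [exact: f0|exact: dfi].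
have CV := IH (Ck_onS Cf).
have := Ck_onM oU (Ck_on_cst k U (-1 : R)) (Ck_onM oU (Ck_onM oU CV CV) Dfi).
apply: Ck_on_ext => // u; rewrite inE => Uu.
rewrite deriveV; [|exact: f0|exact: dfi].
by rewrite expr2 invfM mulN1r -mulNr.
Qed.

Lemma smooth_on_ext {W : normedModType R} U (f g : 'rV[R]_N -> W) :
  open U -> {in U, f =1 g} -> smooth_on U f -> smooth_on U g.
Proof. by move=> oU fg sf k; exact: Ck_on_ext (sf k). Qed.

Lemma smooth_on_cst {W : normedModType R} U (c : W) : smooth_on U (fun=> c).
Proof. by move=> k; exact: Ck_on_cst. Qed.

Lemma smooth_onD {W : normedModType R} U (f g : 'rV[R]_N -> W) : open U ->
  smooth_on U f -> smooth_on U g -> smooth_on U (fun u => f u + g u).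
Proof. by move=> oU sf sg k; exact: Ck_onD. Qed.

Lemma smooth_onM U (f g : 'rV[R]_N -> R) : open U ->
  smooth_on U f -> smooth_on U g -> smooth_on U (fun u => f u * g u).
Proof. by move=> oU sf sg k; exact: Ck_onM. Qed.

Lemma smooth_onV U (f : 'rV[R]_N -> R) : open U -> (forall u, U u -> f u != 0) ->
  smooth_on U f -> smooth_on U (fun u => (f u)^-1).
Proof. by move=> oU f0 sf k; exact: Ck_onV. Qed.

Lemma smooth_onB U (f g : 'rV[R]_N -> R) : open U ->
  smooth_on U f -> smooth_on U g -> smooth_on U (fun u => f u - g u).
Proof.
move=> oU sf sg.
have sNg := smooth_onM oU (smooth_on_cst U (-1 : R)) sg.
by apply: smooth_on_ext (smooth_onD oU sf sNg) => // u _; rewrite mulN1r.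
Qed.

Lemma smooth_on_sum {W : normedModType R} U I (r : seq I) (P : pred I)
    (F : I -> 'rV[R]_N -> W) : open U ->
  (forall i, smooth_on U (F i)) -> smooth_on U (fun u => \sum_(i <- r | P i) F i u).
Proof.
move=> oU sF; elim: r => [|i r IH].
  by apply: smooth_on_ext (smooth_on_cst U 0) => // u _; rewrite big_nil.
case Pi : (P i).
  by apply: smooth_on_ext (smooth_onD oU (sF i) IH) => // u _; rewrite big_cons Pi.
by apply: smooth_on_ext IH => // u _; rewrite big_cons Pi.
Qed.

Lemma smooth_on_prod U I (r : seq I) (P : pred I) (F : I -> 'rV[R]_N -> R) :
  open U ->
  (forall i, smooth_on U (F i)) -> smooth_on U (fun u => \prod_(i <- r | P i) F i u).
Proof.
move=> oU sF; elim: r => [|i r IH].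
  by apply: smooth_on_ext (smooth_on_cst U (1 : R)) => // u _; rewrite big_nil.
case Pi : (P i).
  by apply: smooth_on_ext (smooth_onM oU (sF i) IH) => // u _; rewrite big_cons Pi.
by apply: smooth_on_ext IH => // u _; rewrite big_cons Pi.
Qed.

(** * Smoothness of matrix functions, entry by entry *)

Lemma smooth_on_entry m n U (A : 'rV[R]_N -> 'M[R]_(m, n)) i j : open U ->
  smooth_on U A -> smooth_on U (fun u => A u i j).
Proof.
move=> oU sA k; elim: k A {sA}(sA k) => [|k IH] A [cA dA].
all: have cAij u (Uu : U u) : {for u, continuous (fun u => A u i j)}.
1,3: by apply: (@continuous_comp _ _ _ A (fun M : 'M[R]_(m, n) => M i j));
  [exact: cA|exact: coord_continuous].
  by split.
split=> // l; have [dAl DAl] := dA l; split=> [u Uu|].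
  by have /derivable_mxP := dAl u Uu; apply.
apply: Ck_on_ext (IH _ DAl) => // u; rewrite inE => Uu.
by rewrite (derive_mx (dAl u Uu)) mxE.
Qed.

Lemma smooth_on_det n U (A : 'rV[R]_N -> 'M[R]_n) : open U ->
  (forall i j, smooth_on U (fun u => A u i j)) -> smooth_on U (fun u => \det (A u)).
Proof.
(* Leibniz expansion: a sum over permutations [s] of a constant sign times a product of entries. *)
move=> oU sA; apply: smooth_on_sum => // s.
apply: smooth_onM => //; first exact: smooth_on_cst.
by apply: smooth_on_prod => // i; exact: sA.
Qed.

Lemma smooth_on_invmx n U (A : 'rV[R]_N -> 'M[R]_n) i j : open U ->
  (forall i j, smooth_on U (fun u => A u i j)) ->
  (forall u, U u -> A u \in unitmx) ->
  smooth_on U (fun u => invmx (A u) i j).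
Proof.
move=> oU sA uA.
apply: (@smooth_on_ext _ _ (fun u => (\det (A u))^-1 * cofactor (A u) j i)) => //.
  by move=> u; rewrite inE => Uu; rewrite /invmx uA// !mxE.
apply: smooth_onM => //.
  apply: smooth_onV => //; last exact: smooth_on_det.
  by move=> u Uu; rewrite -unitfE -unitmxE uA.
apply: smooth_onM => //; first exact: smooth_on_cst.
apply: smooth_on_det => // k l.
(* The minor deletes row [j] and column [i], the indices being swapped by the transposition in the
   adjugate. *)
by apply: smooth_on_ext (sA (lift j k) (lift i l)) => // u _; rewrite !mxE.
Qed.

Lemma smooth_on_mulmx m n p U (A : 'rV[R]_N -> 'M[R]_(m, n))
    (B : 'rV[R]_N -> 'M[R]_(n, p)) i j : open U ->
  (forall i j, smooth_on U (fun u => A u i j)) ->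
  (forall i j, smooth_on U (fun u => B u i j)) ->
  smooth_on U (fun u => (A u *m B u) i j).
Proof.
move=> oU sA sB.
have := smooth_on_sum (index_enum 'I_n) xpredT oU
  (fun k => smooth_onM oU (sA i k) (sB k j)).
by apply: smooth_on_ext => // u _; rewrite mxE.
Qed.

End SmoothOn.

(** * Directional derivatives of matrix products and inverses *)

Section MatrixDerivatives.
Set Implicit Arguments.
Unset Strict Implicit.
Unset Printing Implicit Defensive.
Context {R : realType} {V : normedModType R}.

Lemma is_derive_mxP m n (A : V -> 'M[R]_(m, n)) (x v : V) (dA : 'M[R]_(m, n)) :
  is_derive x v A dA <->
  forall i j, is_derive x v (fun y => A y i j) (dA i j).
Proof.
split=> [[DA <-] i j|DA].
  apply: DeriveDef; first by have /derivable_mxP := DA; apply.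
  by rewrite (derive_mx DA) mxE.
have dA' : derivable A x v by apply/derivable_mxP => i j; have [] := DA i j.
apply: DeriveDef => //; rewrite (derive_mx dA').
by apply/matrixP => i j; rewrite mxE; have [] := DA i j.
Qed.

Lemma is_derive_mulmx m n p (A : V -> 'M[R]_(m, n)) (B : V -> 'M[R]_(n, p))
    (x v : V) dA dB : is_derive x v A dA -> is_derive x v B dB ->
  is_derive x v (fun y => A y *m B y) (dA *m B x + A x *m dB).
Proof.
move=> /is_derive_mxP DA /is_derive_mxP DB; apply/is_derive_mxP => i j.
rewrite !mxE -big_split/=.
have -> : (fun y => (A y *m B y) i j) =
    \sum_k ((fun y => A y i k) * (fun y => B y k j)).
  by apply/funext => y; rewrite mxE fct_sumE.
apply: is_derive_sum => k.
apply: is_derive_eq (is_deriveM (DA i k) (DB k j)) _.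
by rewrite addrC [dA i k * _]mulrC.
Qed.

(** Once the inverse is known to be derivable, its derivative is forced: the product of [A] and its
    inverse is constant near [x], and the differentiated identity is solved by multiplying on the
    left by the inverse of [A x]. *)
Lemma is_derive_invmx n (A : V -> 'M[R]_n) (x v : V) dA :
  (\forall y \near x, A y \in unitmx) ->
  derivable (fun y => invmx (A y)) x v -> is_derive x v A dA ->
  is_derive x v (fun y => invmx (A y)) (- (invmx (A x) *m dA *m invmx (A x))).
Proof.
move=> uA dV DA; apply: DeriveDef => //.
have uAx := nbhs_singleton uA.
have [_] := is_derive_mulmx DA (derivableP dV).
have -> : 'D_v (fun y => A y *m invmx (A y)) x = 'D_v (fun=> 1%:M) x.
  by apply: near_eq_derive; apply: filterS uA => y; exact: mulmxV.
rewrite derive_cst => /(congr1 (mulmx (invmx (A x)))).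
rewrite mulmx0 mulmxDr !mulmxA mulVmx// mul1mx => /esym/eqP.
by rewrite addrC addr_eq0 => /eqP.
Qed.

End MatrixDerivatives.

(** * The transformed solution of the symmetric Darboux equations *)

Theorem mainTheorem2 (R : realType) (N m : nat) (U : set 'rV[R]_N)
    (beta : 'I_N -> 'I_N -> 'rV[R]_N -> R)
    (xi : 'I_N -> 'rV[R]_N -> 'cV[R]_m)
    (xis : 'I_N -> 'rV[R]_N -> 'rV[R]_m)
    (Omega : 'rV[R]_N -> 'M[R]_m) (L : 'M[R]_m) :
  open U ->
  symmetric_darboux U beta ->
  (forall i : 'I_N, smooth_on U (xi i)) ->
  (forall i : 'I_N, smooth_on U (xis i)) ->
  (forall i j : 'I_N, i != j -> forall u, U u ->
     is_partial i (xi j) u (beta j i u *: xi i u)) ->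
  (forall i j : 'I_N, i != j -> forall u, U u ->
     is_partial i (xis j) u (beta i j u *: xis i u)) ->
  is_potential U xi xis Omega ->
  (forall u, U u -> Omega u \in unitmx) ->
  (forall i u, U u -> xis i u = (xi i u)^T *m L) ->
  (forall u, U u -> L^T *m Omega u - (Omega u)^T *m L = 0) ->
  symmetric_darboux U (beta_hat beta xi xis Omega).
Proof.
move=> oU [sbeta ebeta bsym] sxi sxis dxi dxis [sOm dOm] uOm xisE LOm.
set V := fun u => invmx (Omega u).
have sOmE i j := @smooth_on_entry _ _ _ _ _ _ i j oU sOm.
have sVE i j : smooth_on U (fun u => V u i j) by apply: smooth_on_invmx.
have dV i u : U u -> is_derive u (delta_mx 0 i) V
    (- (V u *m (xi i u *m xis i u) *m V u)).
  move=> Uu; apply: is_derive_invmx (dOm i u Uu).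
    by apply: filterS (open_nbhs_nbhs (conj oU Uu)).
  (* Derivability of [V] is read off entrywise from its smoothness at order 1. *)
  apply/derivable_mxP => k l; have [_ /(_ i)[+ _]] := sVE k l 1%N.
  exact.
split=> [i j ij|i j k ij jk ik u Uu|i j ij u Uu].
- apply: smooth_onB => //; first exact: sbeta.
  apply: smooth_on_mulmx => // k l; first exact: smooth_on_entry.
  by apply: smooth_on_mulmx => // k' l'; exact: smooth_on_entry.
- have kj : k != j by rewrite eq_sym.
  have ki : k != i by rewrite eq_sym.
  have /is_derive_mxP/(_ 0 0) D := is_derive_mulmx (dxis k j kj u Uu)
    (is_derive_mulmx (dV k u Uu) (dxi k i ki u Uu)).
  apply: is_derive_eq (is_deriveB (ebeta i j k ij jk ik u Uu) D) _.
  rewrite /beta_hat /pairing -/(V u).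
  rewrite mulNmx !mulmxDr mulmxN -!scalemxAl -!scalemxAr !mulmxA.
  (* The rank one derivative of [Omega] splits this term into a product of two 1 by 1 matrices, that
     is, of two scalars. *)
  have -> : xis j u *m V u *m xi k u *m xis k u *m V u *m xi i u =
     (xis j u *m V u *m xi k u) *m (xis k u *m V u *m xi i u).
    by rewrite !mulmxA.
  (* With scalars [P] and [Q], the derivative [beta i k * beta k j - beta k j * Q + P * Q - beta i k
     * P] is the product of [beta i k - Q] and [beta k j - P], which are [beta_hat i k] and
     [beta_hat k j]. *)
  set P := xis j u *m V u *m xi k u; set Q := xis k u *m V u *m xi i u.
  have PQ : (P *m Q) 0 0 = P 0 0 * Q 0 0 by rewrite mxE big_ord1.
  rewrite !mxE in PQ *; rewrite PQ; ring.
- rewrite /beta_hat bsym//; congr (_ - _); rewrite /pairing !xisE//.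
  have LV : (invmx (Omega u))^T *m L^T = L *m invmx (Omega u).
    have /eqP := LOm u Uu; rewrite subr_eq0 => /eqP LO.
    have uT : (Omega u)^T \in unitmx by rewrite unitmx_tr uOm.
    (* On the right, [L] is written as the inverse of [Omega^T] times [Omega^T *m L], and the latter
       is replaced by [L^T *m Omega]; the factor [Omega] then cancels. *)
    rewrite trmx_inv -[L in RHS](mulKmx uT) -LO.
    by rewrite -!mulmxA mulmxV ?uOm// mulmx1.
  (* A 1 by 1 matrix equals its transpose; transposing the correction term exchanges [xi i] and
     [xi j], and [LV] restores the middle factor. *)
  have tr11 (M : 'M[R]_1) : M 0 0 = M^T 0 0 by rewrite mxE.
  rewrite [LHS]tr11 !trmx_mul trmxK.
  by rewrite !mulmxA -[_ *m _ *m L^T]mulmxA LV !mulmxA.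
Qed.
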